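(* Let $\mathbb{T}$ be the unit circle in the complex plane and let $C(\mathbb{T})$ be the Banach space of all continuous functions $f:\mathbb{T}\to\mathbb{C}$ with the norm $\|f\|=\sup\{|f(z)|:z\in\mathbb{T}\}$. Then $C(\mathbb{T})$ has uniform multiplicity infinity of infinite index.
   Context: $\mathcal{B}(X)$ is the set of bounded linear operators on a complex Banach space $X$. A system of matrix units of $\mathcal{B}(X)$ is a family $\{u_{j,k}\}_{j,k=0}^{\infty}\subset\mathcal{B}(X)$ such that (a) $\sup\{\|u_{j,k}\|:j,k\ge 0\}<\infty$; (b) $u_{j,k}u_{l,m}=\delta_{kl}u_{j,m}$ for all $j,k,l,m$ (Kronecker delta); (c) $x=\sum_{k=0}^{\infty}u_{k,k}x$ for every $x\in X$, with convergence in norm. An infinite-dimensional Banach space $X$ has uniform multiplicity infinity of infinite index if there is a system of matrix units $\{u_{j,k}\}_{j,k=0}^\infty$ of $\mathcal{B}(X)$ with $\dim\operatorname{Ran}u_{0,0}=\infty$. *)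

(* Defs.v *)
From HB Require Import structures.
From mathcomp Require Import all_boot all_order all_algebra.
From mathcomp Require Import complex.
From mathcomp Require Import ring.
From mathcomp Require Import all_classical all_reals all_analysis.

Set Implicit Arguments.
Unset Strict Implicit.
Unset Printing Implicit Defensive.

Import Order.TTheory GRing.Theory Num.Theory.
Import numFieldNormedType.Exports.
Import ComplexField.Normc.

Local Open Scope classical_set_scope.
Local Open Scope ring_scope.
Local Open Scope complex_scope.

Section general.
Context {R : realType}.

(* The norm of a normed module over R[i] takes its values in R[i] (in fact in
   its nonnegative real elements), hence the real part. The supremum is taken
   in \bar R: it is +oo when u is unbounded. *)
Definition opnorm (X Y : normedModType R[i]) (u : X -> Y) : \bar R :=
  ereal_sup [set (complex.Re `|u x|)%:E | x in [set x | `|x| <= 1]].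

(* Used for A a linear subspace: dim A >= n for every n. *)
Definition infinite_dimensional (V : lmodType R[i]) (A : set V) : Prop :=
  forall n : nat, exists v : 'I_n -> V,
    (forall i, A (v i)) /\
    (forall a : 'I_n -> R[i], \sum_i a i *: v i = 0 -> forall i, a i = 0).

Record is_matrix_units (X : completeNormedModType R[i])
    (u : nat -> nat -> {linear X -> X}) : Prop := {
  matrix_units_bounded : forall j k, bounded_near (u j k) (nbhs (0 : X)) ;
  matrix_units_unif_bounded :
    (ereal_sup [set opnorm (u jk.1 jk.2) | jk in [set: nat * nat]] < +oo)%E ;
  matrix_units_mul : forall j k l m,
    u j k \o u l m =1 (fun x => (k == l)%:R *: u j m x) ;
  matrix_units_sum : forall x, series (fun k => u k k x) @ \oo --> x }.

Definition has_uniform_multiplicity_infinity_of_infinite_index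
    (X : completeNormedModType R[i]) : Prop :=
  infinite_dimensional [set: X] /\
  exists u : nat -> nat -> {linear X -> X},
    is_matrix_units u /\ infinite_dimensional (range (u 0%N 0%N)).

End general.

(* R[i]^o is R[i] with its structure of normed module over itself. *)
Definition unit_circle (R : realType) : set R[i]^o := [set z | `|z| = 1].
Arguments unit_circle : clear implicits.

Definition CT (R : realType) : Type :=
  continuousType (unit_circle R) (R[i]^o).

Section complex_plane.
Context {R : realType}.
Implicit Types z w : R[i]^o.

Lemma normc_real z : `|z| = (normc z)%:C. Proof. by []. Qed.

Lemma normc_ge0 z : 0 <= normc z.
Proof. by case: z => a b; exact: sqrtr_ge0. Qed.

Lemma normc_distC z w : normc (z - w) = normc (w - z).
Proof. by apply: complexI; exact: (@distrC _ R[i] z w). Qed.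

Lemma normc_triangle y z w : normc (z - w) <= normc (z - y) + normc (y - w).
Proof. by rewrite -lecR rmorphD /=; exact: (@ler_distD R[i] R[i] y z w). Qed.

Lemma normc_sub_le z w : `|normc z - normc w| <= normc (z - w).
Proof.
have h (x y : R[i]) : normc x <= normc (x - y) + normc y.
  by rewrite -{1}(subrK y x); exact: le_normcD.
rewrite ler_norml lerBlDr h andbT lerNl opprB lerBlDr.
by rewrite normc_distC h.
Qed.

Lemma ReB z w : complex.Re (z - w) = complex.Re z - complex.Re w.
Proof. by case: z w => ? ? [? ?]. Qed.

Lemma Re_le_normc z : `|complex.Re z| <= normc z.
Proof. by rewrite -lecR; exact: normc_ge_Re. Qed.

Lemma ImB z w : complex.Im (z - w) = complex.Im z - complex.Im w.
Proof. by case: z w => ? ? [? ?]. Qed.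

Lemma Im_le_normc z : `|complex.Im z| <= normc z.
Proof.
by case: z => a b /=; rewrite -sqrtr_sqr ler_wsqrtr // lerDr sqr_ge0.
Qed.

Lemma normc_le_ReIm z : normc z <= `|complex.Re z| + `|complex.Im z|.
Proof.
case: z => a b /=; rewrite -[leRHS]ger0_norm ?addr_ge0// -sqrtr_sqr.
rewrite ler_wsqrtr// sqrrD !real_normK ?num_real// lerD2r lerDl.
by rewrite mulrn_wge0 // mulr_ge0.
Qed.

Lemma complex_gt0P (e : R[i]) : 0 < e -> exists2 r : R, 0 < r & e = r%:C.
Proof.
move=> e0; have /complex_realP[r er] : e \is Num.real by rewrite gtr0_real.
by exists r => //; rewrite -ltcR -er.
Qed.

Lemma cvg_complexP {T : Type} (F : set_system T) (FF : Filter F)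
    (f : T -> R[i]^o) (l : R[i]^o) :
  f @ F --> l <-> (forall e : R, 0 < e -> \forall x \near F, normc (l - f x) < e).
Proof.
split=> [/cvgrPdist_lt h e e0|h].
  have /h : (0 : R[i]) < e%:C by rewrite ltcR.
  by apply: filterS => x; rewrite normc_real ltcR.
apply/cvgrPdist_lt => e /complex_gt0P[r r0 ->].
by apply: filterS (h r r0) => x; rewrite normc_real ltcR.
Qed.

Lemma contract_continuous (h : R[i]^o -> R) :
  (forall z w, `|h z - h w| <= normc (z - w)) -> continuous h.
Proof.
move=> hle z; apply/(@cvgrPdist_lt _ _ _ (nbhs z)) => e e0.
apply/nbhs_ballP; exists e%:C; first by rewrite /= ltcR.
move=> w; rewrite -ball_normE /= normc_real ltcR; exact: le_lt_trans.
Qed.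

Lemma normc_continuous : continuous (@normc R : R[i]^o -> R).
Proof. exact/contract_continuous/normc_sub_le. Qed.

Lemma complex_continuous (a b : R -> R) :
  continuous a -> continuous b ->
  continuous ((fun t => a t +i* b t) : R -> R[i]^o).
Proof.
move=> ca cb t; apply/(cvg_complexP _) => e e0; near=> s.
rewrite (le_lt_trans (normc_le_ReIm _))//= (splitr e) ltrD//.
- near: s; have /cvgrPdist_lt := ca t; apply; rewrite divr_gt0//.
- near: s; have /cvgrPdist_lt := cb t; apply; rewrite divr_gt0//.
Unshelve. all: by end_near. Qed.

Lemma complex_cauchy_cvg (F : set_system R[i]^o) :
  ProperFilter F -> cauchy F -> cvg F.
Proof.
move=> FF /cauchyP Fc.
have cvg1 (h : R[i]^o -> R) : (forall z w, `|h z - h w| <= normc (z - w)) ->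
    cvg (h @ F).
  move=> hle; apply/cauchy_cvgP/cauchyP => e e0.
  have /Fc[z Fz] : (0 : R[i]) < e%:C by rewrite ltcR.
  exists (h z); suff : F (h @^-1` ball (h z) e) by [].
  apply: filterS Fz => w zw /=; rewrite -ball_normE /=.
  apply: (le_lt_trans (hle z w)); rewrite -ltcR -normc_real.
  by rewrite -ball_normE in zw.
have /cvg_ex[a Fa] := cvg1 (@complex.Re R)
  (fun z w => eq_rect _ (fun t => `|t| <= _) (Re_le_normc _) _ (ReB z w)).
have /cvg_ex[b Fb] := cvg1 (@complex.Im R)
  (fun z w => eq_rect _ (fun t => `|t| <= _) (Im_le_normc _) _ (ImB z w)).
apply/cvg_ex; exists (a +i* b); apply/(cvg_complexP _) => e e0; near=> z.
rewrite (le_lt_trans (normc_le_ReIm _))// (splitr e) ltrD//.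
- rewrite ReB /=; near: z; have /cvgrPdist_lt := Fa; apply; rewrite divr_gt0//.
- rewrite ImB /=; near: z; have /cvgrPdist_lt := Fb; apply; rewrite divr_gt0//.
Unshelve. all: by end_near. Qed.

End complex_plane.

Section circle_parametrization.
Context {R : realType}.
Let clamp (t : R) : R := Num.max (-1) (Num.min 1 t).
Let height (t : R) : R := Num.sqrt (1 - clamp t ^+ 2).

Let clamp_sqr t : clamp t ^+ 2 <= 1.
Proof.
rewrite -real_normK ?num_real// expr_le1// /clamp ler_norml.
by rewrite le_max lexx /= ge_max ge_min lexx /= andbT lerNl -subr_ge0 opprK addr_ge0.
Qed.

Let clamp_continuous : continuous clamp.
Proof.
move=> t; have cst_c (c : R) : {for t, continuous (cst c : R -> R^o)}.
  exact: cvg_cst.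
have id_c : {for t, continuous (id : R -> R^o)} by exact: cvg_id.
exact: (continuous_max (cst_c _) (continuous_min (cst_c _) id_c)).
Qed.

Let height_continuous : continuous height.
Proof.
move=> t; apply: (@continuous_comp _ _ _ (fun t => 1 - clamp t ^+ 2) Num.sqrt).
  apply: cvgB; first exact: cvg_cst.
  by rewrite expr2; apply: cvgM; exact: clamp_continuous.
exact: sqrt_continuous.
Qed.

Let arc_norm (s : bool) t : unit_circle R (clamp t +i* ((-1) ^+ s * height t)).
Proof.
rewrite /unit_circle /mkset normc_real /normc exprMn sqrr_sign mul1r.
by rewrite sqr_sqrtr ?subr_ge0// addrC subrK sqrtr1.
Qed.

Definition arc (s : bool) (t : R) : unit_circle R :=
  exist (fun z => z \in unit_circle R) _ (mem_set (arc_norm s t)).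

Lemma arc_continuous s : continuous (arc s).
Proof.
apply: continuous_comp_initial; apply: complex_continuous => // t.
by apply: cvgM; [exact: cvg_cst|exact: height_continuous].
Qed.

Lemma arc_surj (z : unit_circle R) :
  exists s : bool, exists2 t : R, t \in `[(-1), 1] & arc s t = z.
Proof.
case: z => -[a b] zT; have := set_mem zT; rewrite /unit_circle /mkset.
move=> /complexI /(congr1 (fun x => x ^+ 2)).
rewrite sqr_sqrtr ?addr_ge0 ?sqr_ge0// expr1n => ab1.
have aitv : a \in `[(-1), 1].
  rewrite in_itv /= -ler_norml -(@expr_le1 _ 2%N)// real_normK ?num_real//.
  by rewrite -ab1 lerDl sqr_ge0.
exists (b < 0), a => //; apply: eq_sig_hprop => /= [?|]; first exact: Prop_irrelevance.
have -> : clamp a = a.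
  move: aitv; rewrite in_itv /= => /andP[a1 a2].
  by rewrite /clamp (min_idPr _)// (max_idPr _).
congr (_ +i* _); rewrite /height.
have -> : clamp a = a.
  move: aitv; rewrite in_itv /= => /andP[a1 a2].
  by rewrite /clamp (min_idPr _)// (max_idPr _).
have -> : 1 - a ^+ 2 = b ^+ 2 by rewrite -ab1 addrC addKr.
rewrite sqrtr_sqr.
case: ltP => b0; first by rewrite expr1 mulN1r ltr0_norm ?opprK.
by rewrite expr0 mul1r ger0_norm.
Qed.

End circle_parametrization.

Section CT_lmodule.
Context {R : realType}.
Implicit Types f g h : CT R.

HB.instance Definition _ := Choice.copy (CT R)
  (continuousType (unit_circle R) (R[i]^o)).

Let mk (f : unit_circle R -> R[i]^o) (cf : continuous f) : CT R :=
  HB.pack_for (continuousType (unit_circle R) (R[i]^o)) f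
    (isContinuous.Build _ _ f cf).

Lemma CT_continuous f : continuous (f : unit_circle R -> R[i]^o).
Proof. exact: (@cts_fun _ _ f). Qed.

Let cst_cont (c : R[i]^o) : continuous (fun _ : unit_circle R => c).
Proof. exact: cst_continuous. Qed.

Let opp_cont f : continuous (fun x => - f x).
Proof. by move=> x; exact: (cvgN (@CT_continuous f x)). Qed.

Let add_cont f g : continuous (fun x => f x + g x).
Proof. by move=> x; exact: (cvgD (@CT_continuous f x) (@CT_continuous g x)). Qed.

Let scale_cont (a : R[i]) f : continuous (fun x => a *: f x).
Proof. by move=> x; exact: (cvgZr (@CT_continuous f x)). Qed.

Definition CT_zero : CT R := mk (@cst_cont 0).
Definition CT_opp f : CT R := mk (@opp_cont f).
Definition CT_add f g : CT R := mk (@add_cont f g).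
Definition CT_scale (a : R[i]) f : CT R := mk (@scale_cont a f).

Let addA : associative CT_add.
Proof. by move=> f g h; apply/continuousEP => x; exact: addrA. Qed.

Let addC : commutative CT_add.
Proof. by move=> f g; apply/continuousEP => x; exact: addrC. Qed.

Let add0 : left_id CT_zero CT_add.
Proof. by move=> f; apply/continuousEP => x; exact: add0r. Qed.

Let addN : left_inverse CT_zero CT_opp CT_add.
Proof. by move=> f; apply/continuousEP => x; exact: addNr. Qed.

HB.instance Definition _ := GRing.isZmodule.Build (CT R) addA addC add0 addN.

Let scaleA a b f : CT_scale a (CT_scale b f) = CT_scale (a * b) f.
Proof. by apply/continuousEP => x; exact: scalerA. Qed.

Let scale1 : left_id 1 CT_scale.
Proof. by move=> f; apply/continuousEP => x; exact: scale1r. Qed.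

Let scaleDr : right_distributive CT_scale +%R.
Proof. by move=> a f g; apply/continuousEP => x; exact: scalerDr. Qed.

Let scaleDl f : {morph CT_scale^~ f : a b / a + b}.
Proof. by move=> a b; apply/continuousEP => x; exact: scalerDl. Qed.

HB.instance Definition _ :=
  GRing.Zmodule_isLmodule.Build R[i] (CT R) scaleA scale1 scaleDr scaleDl.

Lemma CT_ext f g : (forall z, f z = g z) -> f = g.
Proof. by move=> fg; apply/continuousEP. Qed.

Lemma CT0E z : (0 : CT R) z = 0. Proof. by []. Qed.

Lemma CTDE f g z : (f + g) z = f z + g z. Proof. by []. Qed.

Lemma CTNE f z : (- f) z = - f z. Proof. by []. Qed.

Lemma CTZE (a : R[i]) f z : (a *: f) z = a * f z. Proof. by []. Qed.

End CT_lmodule.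

Section CT_norm.
Context {R : realType}.
Implicit Types f g h : CT R.

(* normc is the R-valued modulus: `|z| = (normc z)%:C. The set below is nonempty
   and bounded above (CT_has_sup), so that sup is a genuine supremum. *)
Definition CT_norm f : R := sup (range (fun z => normc (f z))).

Lemma CT_has_sup f : has_sup (range (fun z => normc (f z))).
Proof.
split; first by exists (normc (f (arc false 0))), (arc false 0).
have bnd s : exists M, forall t, t \in `[(-1), 1] -> normc (f (arc s t)) <= M.
  have [|//|c _ cM] :=
      @EVT_max R (fun t => normc (f (arc s t))) (-1) 1.
  - by rewrite -subr_ge0 opprK addr_ge0.
  - apply: continuous_subspaceT => t.
    apply: (@continuous_comp _ _ _ (f \o arc s) (@normc R)).
      by apply: continuous_comp; [exact: arc_continuous|exact: CT_continuous].
    exact: normc_continuous.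
  - by exists (normc (f (arc s c))).
have [M0 M0P] := bnd false; have [M1 M1P] := bnd true.
exists (Num.max M0 M1) => _ [z _ <-].
have [[] [t tI <-]] := arc_surj z; rewrite le_max.
  by rewrite M1P ?orbT.
by rewrite M0P.
Qed.

Lemma CT_norm_ub f z : normc (f z) <= CT_norm f.
Proof. by apply: sup_upper_bound; [exact: CT_has_sup|exists z]. Qed.

Lemma CT_norm_le f (M : R) : (forall z, normc (f z) <= M) -> CT_norm f <= M.
Proof.
move=> fM; apply: ge_sup; first by case: (CT_has_sup f).
by move=> _ [z _ <-].
Qed.

Lemma CT_norm_ge0 f : 0 <= CT_norm f.
Proof. exact: le_trans (normc_ge0 _) (CT_norm_ub f (arc false 0)). Qed.

Let normD f g : (CT_norm (f + g))%:C <= (CT_norm f)%:C + (CT_norm g)%:C.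
Proof.
rewrite -rmorphD /= lecR; apply: CT_norm_le => z; rewrite CTDE.
by apply: (le_trans (le_normcD _ _)); rewrite lerD// CT_norm_ub.
Qed.

Let normZ_le (a : R[i]) f : CT_norm (a *: f) <= normc a * CT_norm f.
Proof.
apply: CT_norm_le => z; rewrite CTZE normcM ler_wpM2l ?normc_ge0//.
exact: CT_norm_ub.
Qed.

Let normZ (a : R[i]) f : (CT_norm (a *: f))%:C = `|a| * (CT_norm f)%:C.
Proof.
rewrite (normc_real a) -rmorphM /=; congr (_%:C).
apply/eqP; rewrite eq_le normZ_le /=.
have [->|a0] := eqVneq a 0; first by rewrite normc0 mul0r CT_norm_ge0.
have na0 : 0 < normc a.
  rewrite lt_neqAle normc_ge0 andbT eq_sym.
  by apply: contra a0 => /eqP/eq0_normc ->.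
rewrite -ler_pdivlMl// -normcV.
by rewrite -{1}(scale1r f) -(mulVf a0) -scalerA; exact: normZ_le.
Qed.

Let norm0 f : (CT_norm f)%:C = 0 -> f = 0.
Proof.
move=> /complexI f0; apply: CT_ext => z; apply: eq0_normc.
by apply/eqP; rewrite eq_le normc_ge0 andbT -f0 CT_norm_ub.
Qed.

HB.instance Definition _ :=
  Lmodule_isNormed.Build R[i] (CT R) normD normZ norm0.

Lemma CT_normE f : `|f| = (sup (range (fun z => normc (f z))))%:C.
Proof. by []. Qed.

Lemma CT_cauchy_cvg (F : set_system (CT R)) :
  ProperFilter F -> cauchy F -> cvg F.
Proof.
move=> FF /cauchyP Fc; have F' : Filter F by typeclasses eauto.
have Fcauchy (e : R) : 0 < e ->
    exists f, F [set g | forall z, normc (f z - g z) < e].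
  move=> e0; have /Fc[f Ff] : (0 : R[i]) < e%:C by rewrite ltcR.
  exists f; apply: filterS Ff => g; rewrite -ball_normE /= CT_normE ltcR => fg z.
  by apply: le_lt_trans fg; exact: (CT_norm_ub (f - g)).
have /choice[l lP] z : exists l : R[i]^o, (fun f : CT R => f z : R[i]^o) @ F --> l.
  apply/cvg_ex; apply: complex_cauchy_cvg; apply/cauchyP => e /complex_gt0P[r r0 ->].
  have [f Ff] := Fcauchy r r0; exists (f z).
  suff : F [set g : CT R | ball (f z) r%:C (g z)] by [].
  by apply: filterS Ff => g /= fg; rewrite -ball_normE /= normc_real ltcR.
have unif (e : R) : 0 < e -> F [set g | forall z, normc (l z - g z) <= e].
  move=> e0; have e20 : 0 < e / 2 by rewrite divr_gt0.
  have [f Ff] := Fcauchy _ e20.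
  have lf z : normc (l z - f z) <= e / 2.
    apply/ler_addgt0Pr => d d0.
    have Fl := (cvg_complexP F' _ _).1 (lP z) d d0.
    have [g [lg fg]] := filter_ex (filterI Fl Ff).
    rewrite (le_trans (normc_triangle (g z) _ _))// addrC.
    by rewrite lerD// ?(ltW lg)// normc_distC (ltW (fg z)).
  apply: filterS Ff => g fg z.
  rewrite (le_trans (normc_triangle (f z) _ _))// [leRHS](splitr e).
  by rewrite lerD// (ltW (fg z)).
have l_cont : continuous l.
  move=> z; apply/(cvg_complexP (nbhs_filter z)) => e e0.
  have e30 : 0 < e / 3 by rewrite divr_gt0.
  have [g gl] := filter_ex (unif _ e30).
  have gz : g @ z --> g z by exact: CT_continuous.
  have := (cvg_complexP (nbhs_filter z) _ _).1 gz _ e30.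
  apply: filterS => w gzw.
  have -> : e = e / 3 + (e / 3 + e / 3) by field.
  apply: le_lt_trans (normc_triangle (g z) _ _) _; apply: ler_ltD => //.
  apply: le_lt_trans (normc_triangle (g w) _ _) _; apply: ltr_leD => //.
  by rewrite normc_distC.
pose L : CT R := HB.pack_for (continuousType (unit_circle R) (R[i]^o)) l
  (isContinuous.Build _ _ l l_cont).
apply/cvg_ex; exists L; apply/(@cvgrPdist_le _ _ _ F) => e /complex_gt0P[r r0 ->].
apply: filterS (unif r r0) => g lg.
by rewrite CT_normE lecR; exact: CT_norm_le.
Qed.

HB.instance Definition _ := Uniform_isComplete.Build (CT R) CT_cauchy_cvg.

End CT_norm.

(* Main.v *)
From Pilot Require Import Defs.
From HB Require Import structures.
From mathcomp Require Import all_boot all_order all_algebra.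
From mathcomp Require Import complex.
From mathcomp Require Import ring lra.
From mathcomp Require Import all_classical all_reals all_analysis.

Set Implicit Arguments.
Unset Strict Implicit.
Unset Printing Implicit Defensive.

Import Order.TTheory GRing.Theory Num.Theory.
Import numFieldNormedType.Exports.
Import ComplexField.Normc.
Import Pilot.Defs.

Local Open Scope classical_set_scope.
Local Open Scope ring_scope.
Local Open Scope complex_scope.

(** The matrix units come from a pair of operators A, B on C(T) with B A = 1.
   Put P = 1 - A B; then B P = 0 and P A = 0, so the operators
   u_jk = A^j P B^k = A^j B^k - A^(j+1) B^(k+1) satisfy the relations of matrix
   units, and their diagonal sums telescope to 1 - A^n B^n. Everything else
   follows from three properties of the pair (is_matrix_units_shift,
   ker_sub_range_shift_unit):
   - the powers of A and of B are uniformly bounded, whence the u_jk are;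
   - B^n f tends to 0 for each f, whence the diagonal sums converge to f;
   - the kernel of B, which lies in the range of u_00 = P, is
     infinite-dimensional.

   The operator B, called zoom, looks at f on the closed upper half circle only
   and stretches this half circle around the whole circle. Two corrections are
   made. Subtracting f(1) makes the powers tend to 0: B^n f depends on the
   differences f - f(1) on an arc that starts at 1 and has n times been halved
   in the coordinate Re z (iter_zoom_arc_false), and f is continuous at 1. The
   stretched function takes the values f(1) and f(-1) at the two ends of the
   half circle, which become the same point; the jump b = f(-1) - f(1) is
   compensated by adding b on the upper half and a function that falls
   linearly from b to 0 on the lower half. Then (B f)(1) = b, so B f need not
   vanish at 1, and B is onto: the right inverse A, called squeeze, squeezes a
   function into the upper half circle, undoes the compensation, and joins the
   two ends linearly in Re z on the lower half circle. The functions A h all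
   vanish at 1, and A does not increase the norm of functions that vanish at 1;
   so A^n is no larger than A. Finally B kills every function that
   vanishes on the upper half circle.

   Continuous functions on T are handled as pairs of functions of x = Re z, one
   for each closed half circle, with the same values at x = 1 and at x = -1. *)

(** * Matrix units from a one-sided shift *)

Section shift_matrix_units.
Context {R : realType} {X : completeNormedModType R[i]}.

Fixpoint linear_iter (n : nat) (A : {linear X -> X}) : {linear X -> X} :=
  if n is m.+1 then (A \o linear_iter m A : {linear X -> X})
  else (idfun : {linear X -> X}).

Lemma linear_iterE n (A : {linear X -> X}) x : linear_iter n A x = iter n A x.
Proof. by elim: n => //= n ->. Qed.

(** For cancel A B this is A^j (1 - A B) B^k (shift_unitE); the difference is
   the form in which norm bounds and the telescoping of the diagonal are
   immediate. *)
Definition shift_unit (A B : {linear X -> X}) (j k : nat) : {linear X -> X} :=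
  ((linear_iter j A \o linear_iter k B)
   \- (linear_iter j.+1 A \o linear_iter k.+1 B) : {linear X -> X}).

Variables A B : {linear X -> X}.
Hypothesis AK : cancel A B.

Let P x := x - A (B x).

Lemma shift_unitE j k x : shift_unit A B j k x = iter j A (P (iter k B x)).
Proof.
rewrite /= !linear_iterE /P -(linear_iterE j A (_ - _)) linearB.
by rewrite !linear_iterE -iterS iterSr.
Qed.

Lemma iter_cancel n : cancel (iter n A) (iter n B).
Proof. by elim: n => // n IH x; rewrite iterSr iterS AK IH. Qed.

Let BP x : B (P x) = 0.
Proof. by rewrite /P linearB AK subrr. Qed.

Let PA x : P (A x) = 0.
Proof. by rewrite /P AK subrr. Qed.

Let P0 : P 0 = 0.
Proof. by rewrite -[X in P X](linear0 A) PA. Qed.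

(** The middle factor P B^k A^l P reduces by B A = 1 to P A^(l-k) P or to
   P B^(k-l) P; both vanish for k <> l because P A = 0 and B P = 0. *)
Lemma shift_unit_mul j k l m x :
  shift_unit A B j k (shift_unit A B l m x) = (k == l)%:R *: shift_unit A B j m x.
Proof.
have iter0 n : iter n A 0 = 0 by rewrite -linear_iterE linear0.
have iterB0 n : iter n B 0 = 0 by rewrite -linear_iterE linear0.
rewrite !shift_unitE; set y := iter m B x.
case: (ltngtP k l) => [kl|lk|->].
- rewrite scale0r -(subnKC (ltnW kl)) iterD iter_cancel.
  by rewrite -[(l - k)%N]prednK ?subn_gt0// iterS PA iter0.
- rewrite scale0r -(subnK (ltnW lk)) iterD iter_cancel.
  by rewrite -[(k - l)%N]prednK ?subn_gt0// iterSr BP iterB0 P0 iter0.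
- by rewrite scale1r iter_cancel {1}/P BP linear0 subr0.
Qed.

Lemma shift_unit_series n x :
  series (fun k => shift_unit A B k k x) n = x - iter n A (iter n B x).
Proof.
rewrite /series /= big_mkord; elim: n => [|n IH].
  by rewrite big_ord0 /= subrr.
by rewrite big_ord_recr /= IH !linear_iterE addrA subrK.
Qed.

Variables K L : R.
Hypotheses (K_ge0 : 0 <= K) (L_ge0 : 0 <= L).
Hypotheses (AKle : forall n x, `|iter n A x| <= K%:C * `|x|)
  (BLle : forall n x, `|iter n B x| <= L%:C * `|x|).
Hypothesis B_cvg0 : forall x, (fun n => iter n B x) @ \oo --> (0 : X).

Lemma shift_unit_le j k x :
  `|shift_unit A B j k x| <= (K * L + K * L)%:C * `|x|.
Proof.
have h n m : `|iter n A (iter m B x)| <= (K * L)%:C * `|x|.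
  rewrite rmorphM /= -mulrA (le_trans (AKle _ _))// ler_wpM2l ?lecR//.
rewrite /= !linear_iterE (le_trans (ler_normB _ _))// rmorphD /= mulrDl.
by rewrite lerD ?h // (h j.+1 k.+1).
Qed.

(** As the A^n are uniformly bounded, strong convergence of B^n to 0 is enough
   for the remainder A^n B^n x of the diagonal series to vanish in the limit. *)
Lemma is_matrix_units_shift : is_matrix_units (shift_unit A B).
Proof.
split.
- move=> j k; apply/linear_boundedP; near=> r => x.
  rewrite (le_trans (shift_unit_le _ _ _))// ler_wpM2r//.
  near: r; apply: nbhs_pinfty_ge; apply: ger0_real.
  by rewrite lecR addr_ge0// mulr_ge0.
- apply: (@le_lt_trans _ _ (K * L + K * L)%:E); last exact: ltry.
  apply: ge_ereal_sup => _ [[j k] _ <-] /=.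
  apply: ge_ereal_sup => _ [x x1 <-]; rewrite lee_fin.
  rewrite -lecR RRe_real ?ger0_real// (le_trans (shift_unit_le _ _ _))//.
  by rewrite ler_piMr// lecR addr_ge0// mulr_ge0.
- by move=> j k l m x; exact: shift_unit_mul.
- move=> x; rewrite (_ : series _ = fun n => x - iter n A (iter n B x)); last first.
    by apply/funext => n; exact: shift_unit_series.
  rewrite -[X in _ --> X]subr0; apply: cvgB; first exact: cvg_cst.
  apply/cvgr0Pnorm_le => e e0.
  (* K + 1 rather than K, which may be 0. *)
  have K1 : 0 < (K + 1)%:C :> R[i] by rewrite ltcR ltr_wpDl.
  have /cvgr0Pnorm_le/(_ _ (divr_gt0 e0 K1)) := B_cvg0 x.
  apply: filterS => n Bn; rewrite (le_trans (AKle _ _))//.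
  rewrite -[leRHS](divfK (lt0r_neq0 K1)) [leRHS]mulrC ler_pM ?lecR//.
  by rewrite lerDl.
Unshelve. all: by end_near.
Qed.

Lemma ker_sub_range_shift_unit x : B x = 0 -> range (shift_unit A B 0 0) x.
Proof. by move=> Bx; exists x => //; rewrite shift_unitE /= /P Bx linear0 subr0. Qed.

End shift_matrix_units.

(** * Gluing continuous functions along the two half circles *)

Section glue.
Context {R : realType}.
Implicit Types (z w : unit_circle R) (x : R) (p q : R -> R[i]^o).

Lemma arcE s x : x \in `[(-1), 1] ->
  set_val (arc s x) = x +i* ((-1) ^+ s * Num.sqrt (1 - x ^+ 2)).
Proof.
rewrite in_itv /= => /andP[x1 x2]; rewrite /arc /set_val /=.
by rewrite (min_idPr _)// (max_idPr _).
Qed.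

Let unit_circle_inj z w : set_val z = set_val w -> z = w.
Proof. by move=> ?; apply: eq_sig_hprop => // ?; exact: Prop_irrelevance. Qed.

Lemma arc_geN1 s x : x <= -1 -> arc s x = arc false (-1).
Proof.
move=> x1; apply: unit_circle_inj; rewrite /arc /set_val /=.
have x11 : x <= 1 by lra.
have N11 : (-1 : R) <= 1 by lra.
rewrite (min_idPr _)// (max_idPl _)// (min_idPr _)// maxxx.
by rewrite sqrrN expr1n subrr sqrtr0 !mulr0.
Qed.

Lemma arc1 s : arc s 1 = arc false (1 : R).
Proof.
have I1 : (1 : R) \in `[(-1), 1] by rewrite in_itv /= lexx andbT; lra.
by apply: unit_circle_inj; rewrite !arcE// expr1n subrr sqrtr0 !mulr0.
Qed.

Definition glue_fun p q z : R[i]^o :=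
  if 0 <= complex.Im (set_val z) then p (complex.Re (set_val z))
  else q (complex.Re (set_val z)).

Lemma Re_continuous : continuous (fun z => complex.Re (set_val z)).
Proof.
move=> z; apply: (@continuous_comp (unit_circle R) R[i]^o R set_val
    (@complex.Re R : R[i]^o -> R)).
  exact: initial_continuous.
by apply: contract_continuous => u v; rewrite -ReB Re_le_normc.
Qed.

Lemma Im_continuous : continuous (fun z => complex.Im (set_val z)).
Proof.
move=> z; apply: (@continuous_comp (unit_circle R) R[i]^o R set_val
    (@complex.Im R : R[i]^o -> R)).
  exact: initial_continuous.
by apply: contract_continuous => u v; rewrite -ImB Im_le_normc.
Qed.

Lemma Im0_Re z : complex.Im (set_val z) = 0 ->
  complex.Re (set_val z) = 1 \/ complex.Re (set_val z) = -1.
Proof.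
have [s [t tI <-]] := arc_surj z; rewrite arcE//= => /eqP.
rewrite mulf_eq0 signr_eq0 /= sqrtr_eq0 subr_le0 => t1.
have : t ^+ 2 == 1 ^+ 2.
  rewrite expr1n eq_le t1 andbT.
  by move: tI; rewrite in_itv /= => /andP[]; nra.
by rewrite eqf_sqr => /orP[]/eqP ->; [left|right].
Qed.

(** Where Im z <> 0 the glued function agrees near z with one of the two pieces;
   the points with Im z = 0 are 1 and -1, where both pieces are continuous with
   the same value. *)
Lemma glue_continuous p q : continuous p -> continuous q ->
  p 1 = q 1 -> p (-1) = q (-1) -> continuous (glue_fun p q).
Proof.
move=> cp cq pq1 pqN1 z.
have cP : (fun w => p (complex.Re (set_val w))) @ z --> p (complex.Re (set_val z)).
  exact: (continuous_comp (@Re_continuous z) (@cp _)).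
have cQ : (fun w => q (complex.Re (set_val w))) @ z --> q (complex.Re (set_val z)).
  exact: (continuous_comp (@Re_continuous z) (@cq _)).
have cI := @Im_continuous z.
rewrite /continuous_at {2}/glue_fun.
have [Iz|Iz|Iz] := ltgtP 0 (complex.Im (set_val z)).
- apply: cvg_trans cP; apply: (@near_eq_cvg _ _ (nbhs z)); near=> w.
  rewrite /glue_fun ifT//; apply: ltW; near: w.
  exact: (cvgr_gt _ cI).
- apply: cvg_trans cQ; apply: (@near_eq_cvg _ _ (nbhs z)); near=> w.
  rewrite /glue_fun ifF//; apply/negbTE; rewrite -ltNge; near: w.
  exact: (cvgr_lt _ cI).
- have PQ : q (complex.Re (set_val z)) = p (complex.Re (set_val z)).
    by have [->|->] := Im0_Re (esym Iz).
  apply/(cvg_complexP (nbhs_filter z)) => e e0.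
  have := (cvg_complexP (nbhs_filter z) _ _).1 cP e e0.
  have := (cvg_complexP (nbhs_filter z) _ _).1 cQ e e0.
  by rewrite PQ; apply: filterS2 => w; rewrite /glue_fun; case: ifP.
Unshelve. all: by end_near. Qed.

Definition glue p q (cp : continuous p) (cq : continuous q)
    (pq1 : p 1 = q 1) (pqN1 : p (-1) = q (-1)) : CT R :=
  HB.pack_for (continuousType (unit_circle R) (R[i]^o)) (glue_fun p q)
    (isContinuous.Build _ _ (glue_fun p q) (glue_continuous cp cq pq1 pqN1)).

(** The point arc true x lies on the upper half circle only when it is 1 or -1,
   and there p and q agree. *)
Lemma glueE p q (cp : continuous p) (cq : continuous q)
    (pq1 : p 1 = q 1) (pqN1 : p (-1) = q (-1)) s x : x \in `[(-1), 1] ->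
  glue cp cq pq1 pqN1 (arc s x) = if s then q x else p x.
Proof.
move=> xI; rewrite /glue /= /glue_fun arcE//=.
case: s; last by rewrite expr0 mul1r sqrtr_ge0.
rewrite expr1 mulN1r oppr_ge0; case: ifP => // I0.
have : complex.Im (set_val (arc true x)) = 0.
  rewrite arcE//= expr1 mulN1r; apply/eqP; rewrite oppr_eq0 eq_le I0.
  exact: sqrtr_ge0.
by move=> /Im0_Re; rewrite arcE//= => -[] ->.
Qed.

Lemma CT_ext_arc (f g : CT R) :
  (forall s x, x \in `[(-1), 1] -> f (arc s x) = g (arc s x)) -> f = g.
Proof.
by move=> fg; apply: CT_ext => z; have [s [t tI <-]] := arc_surj z; exact: fg.
Qed.

Lemma CT_norm_le_arc (f : CT R) (M : R) :
  (forall s x, x \in `[(-1), 1] -> normc (f (arc s x)) <= M) -> CT_norm f <= M.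
Proof.
by move=> fg; apply: CT_norm_le => z; have [s [t tI <-]] := arc_surj z; exact: fg.
Qed.

End glue.

(** * The zoom operator and its right inverse *)

Section operators.
Context {R : realType}.
Implicit Types (f h : CT R) (x : R).

Local Notation pt1 := (arc false (1 : R)).
Local Notation ptN1 := (arc false (-1 : R)).

Lemma comp_arc_continuous f s (a : R -> R) : continuous a ->
  continuous (fun x => f (arc s (a x)) : R[i]^o).
Proof.
move=> ca x; apply: (@continuous_comp _ _ _ a (f \o arc s)); first exact: ca.
by apply: continuous_comp; [exact: arc_continuous|exact: CT_continuous].
Qed.

Lemma weight_continuous (w : R -> R) (c : R[i]) : continuous w ->
  continuous (fun x => (w x)%:C * c : R[i]^o).
Proof.
move=> cw; case: c => a b.
have -> : (fun x => (w x)%:C * (a +i* b)) = (fun x => (w x * a) +i* (w x * b)).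
  by apply/funext => x; congr (_ +i* _); rewrite !mul0r ?subr0 ?addr0.
by apply: complex_continuous => x; apply: cvgMr_tmp; exact: cw.
Qed.

Let half_continuous : continuous (fun x => (1 + x) / 2 : R).
Proof. by move=> x; apply: cvgMr_tmp; apply: cvgD; [exact: cvg_cst|exact: cvg_id]. Qed.

(** The upper half circle in the zoomed picture is the quarter 0 <= Re z of the
   original one, and the lower half circle is the quarter Re z <= 0; on the
   latter the compensation of the jump falls from f(-1) - f(1) at x = -1 to 0
   at x = 1. *)
Definition zoom_up f x : R[i]^o := f (arc false ((1 + x) / 2)) - f pt1 + (f ptN1 - f pt1).
Definition zoom_lo f x : R[i]^o :=
  f (arc false (- ((1 + x) / 2))) - f pt1 + (1 - (1 + x) / 2)%:C * (f ptN1 - f pt1).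

Lemma zoom_up_continuous f : continuous (zoom_up f).
Proof.
move=> x; apply: cvgD; last exact: cvg_cst; apply: cvgB; last exact: cvg_cst.
exact: (comp_arc_continuous half_continuous).
Qed.

Lemma zoom_lo_continuous f : continuous (zoom_lo f).
Proof.
have cN : continuous (fun x => - ((1 + x) / 2) : R).
  by move=> x; apply: cvgN; exact: half_continuous.
have c1 : continuous (fun x => 1 - (1 + x) / 2 : R).
  by move=> x; apply: cvgB; [exact: cvg_cst|exact: half_continuous].
move=> x; apply: cvgD; last exact: weight_continuous c1 _.
by apply: cvgB; [exact: comp_arc_continuous cN _|exact: cvg_cst].
Qed.

Lemma zoom_glue1 f : zoom_up f 1 = zoom_lo f 1.
Proof.
rewrite /zoom_up /zoom_lo (_ : (1 + 1) / 2 = 1 :> R); last by field.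
by rewrite !subrr mul0r add0r addr0.
Qed.

Lemma zoom_glueN1 f : zoom_up f (-1) = zoom_lo f (-1).
Proof. by rewrite /zoom_up /zoom_lo subrr mul0r oppr0 addr0 mul1r. Qed.

Definition zoom f : CT R := glue (zoom_up_continuous (f := f))
  (zoom_lo_continuous (f := f)) (zoom_glue1 f) (zoom_glueN1 f).

Lemma zoomE f s x : x \in `[(-1), 1] ->
  zoom f (arc s x) = if s then zoom_lo f x else zoom_up f x.
Proof. exact: glueE. Qed.

Let zoom_linear : linear zoom.
Proof.
move=> a f g; apply: CT_ext_arc => s x xI.
rewrite CTDE CTZE !zoomE//; case: s; rewrite /zoom_lo /zoom_up !CTDE !CTZE; ring.
Qed.

HB.instance Definition _ :=
  GRing.isLinear.Build R[i] (CT R) (CT R) *:%R zoom zoom_linear.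

(** Inverse of the two formulas of zoom. As arc is constant beyond the ends of
   [-1, 1], one of the first two terms equals h(-1) on each side of x = 0, so
   the sum covers both cases without a case distinction (squeeze_up_ge0,
   squeeze_up_le0). *)
Definition squeeze_up h x : R[i]^o :=
  h (arc false (2 * x - 1)) + h (arc true (- 1 - 2 * x)) - h ptN1
  - (1 - Num.max (- x) 0)%:C * h pt1.
Definition squeeze_lo h x : R[i]^o := ((1 - x) / 2)%:C * h pt1.

Lemma squeeze_up_continuous h : continuous (squeeze_up h).
Proof.
have c1 : continuous (fun x => 2 * x - 1 : R).
  move=> x; apply: cvgB; last exact: cvg_cst.
  by apply: cvgMl_tmp; exact: cvg_id.
have c2 : continuous (fun x => - 1 - 2 * x : R).
  move=> x; apply: cvgB; first exact: cvg_cst.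
  by apply: cvgMl_tmp; exact: cvg_id.
have c3 : continuous (fun x => 1 - Num.max (- x) 0 : R).
  move=> x; apply: cvgB; first exact: cvg_cst.
  apply: (@continuous_max R R -%R (cst 0)); last exact: cvg_cst.
  by apply: cvgN; exact: cvg_id.
move=> x; apply: cvgB; last exact: weight_continuous c3 _.
apply: cvgB; last exact: cvg_cst.
by apply: cvgD; [exact: comp_arc_continuous c1 _|exact: comp_arc_continuous c2 _].
Qed.

Lemma squeeze_lo_continuous h : continuous (squeeze_lo h).
Proof.
apply: weight_continuous => x; apply: cvgMr_tmp.
apply: cvgB; [exact: cvg_cst|exact: cvg_id].
Qed.

Lemma squeeze_up_ge0 h x : 0 <= x ->
  squeeze_up h x = h (arc false (2 * x - 1)) - h pt1.
Proof.
move=> x0; rewrite /squeeze_up (@arc_geN1 _ true); last by lra.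
by rewrite addrK (max_idPr _) ?oppr_le0// subr0 mul1r.
Qed.

Lemma squeeze_up_le0 h x : x <= 0 ->
  squeeze_up h x = h (arc true (- 1 - 2 * x)) - (1 + x)%:C * h pt1.
Proof.
move=> x0; rewrite /squeeze_up (@arc_geN1 _ false); last by lra.
by rewrite [h ptN1 + _]addrC addrK (max_idPl _) ?oppr_ge0// opprK.
Qed.

Lemma squeeze_glue1 h : squeeze_up h 1 = squeeze_lo h 1.
Proof.
rewrite squeeze_up_ge0// /squeeze_lo subrr !mul0r mulr1.
by rewrite (_ : 2 - 1 = 1 :> R) ?subrr//; ring.
Qed.

Lemma squeeze_glueN1 h : squeeze_up h (-1) = squeeze_lo h (-1).
Proof.
rewrite squeeze_up_le0 ?oppr_le0// /squeeze_lo subrr mul0r subr0.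
rewrite (_ : -1 - 2 * -1 = 1 :> R); last by ring.
by rewrite arc1 (_ : (1 - -1) / 2 = 1 :> R) ?mul1r//; field.
Qed.

Definition squeeze h : CT R := glue (squeeze_up_continuous (h := h))
  (squeeze_lo_continuous (h := h)) (squeeze_glue1 h) (squeeze_glueN1 h).

Lemma squeezeE f s x : x \in `[(-1), 1] ->
  squeeze f (arc s x) = if s then squeeze_lo f x else squeeze_up f x.
Proof. exact: glueE. Qed.

Let squeeze_linear : linear squeeze.
Proof.
move=> a f g; apply: CT_ext_arc => s x xI.
rewrite CTDE CTZE !squeezeE//.
case: s; rewrite /squeeze_lo /squeeze_up !CTDE !CTZE; ring.
Qed.

HB.instance Definition _ :=
  GRing.isLinear.Build R[i] (CT R) (CT R) *:%R squeeze squeeze_linear.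

Let I1 : (1 : R) \in `[(-1), 1].
Proof. by rewrite in_itv /= lexx andbT; lra. Qed.

Let IN1 : (-1 : R) \in `[(-1), 1].
Proof. by rewrite in_itv /= lexx /=; lra. Qed.

Lemma squeeze_pt1 h : squeeze h pt1 = 0.
Proof. by rewrite squeezeE// squeeze_glue1 /squeeze_lo subrr !mul0r. Qed.

Lemma squeeze_ptN1 h : squeeze h ptN1 = h pt1.
Proof.
rewrite squeezeE// squeeze_glueN1 /squeeze_lo.
by rewrite (_ : (1 - -1) / 2 = 1 :> R) ?mul1r//; field.
Qed.

Lemma squeezeK : cancel squeeze zoom.
Proof.
move=> h; apply: CT_ext_arc => s x xI; rewrite zoomE//.
have [x1 x2] : -1 <= x /\ x <= 1 by move: xI; rewrite in_itv /= => /andP[].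
rewrite /zoom_lo /zoom_up squeeze_pt1 squeeze_ptN1 !subr0; case: s.
- rewrite squeezeE; last by rewrite in_itv /=; lra.
  rewrite squeeze_up_le0; last by lra.
  by rewrite subrK; congr (h (arc _ _)); field.
- rewrite squeezeE; last by rewrite in_itv /=; lra.
  rewrite squeeze_up_ge0; last by lra.
  by rewrite subrK; congr (h (arc _ _)); field.
Qed.

Lemma zoom_arc_false f x : -1 <= x <= 1 ->
  zoom f (arc false x) - zoom f pt1 = f (arc false ((1 + x) / 2)) - f pt1.
Proof.
move=> xI; rewrite !zoomE// /zoom_up.
by rewrite (_ : (1 + 1) / 2 = 1 :> R) -?/pt1; [ring|field].
Qed.

(** On the upper half circle, zoom acts on differences of values with the value
   at 1 as composition with the map x |-> (1 + x) / 2, which halves the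
   distance to 1. *)
Lemma iter_zoom_arc_false n f x : -1 <= x <= 1 ->
  iter n zoom f (arc false x) - iter n zoom f pt1
  = f (arc false (1 - (1 - x) / 2 ^+ n)) - f pt1.
Proof.
elim: n f x => [|n IH] f x xI.
  by rewrite expr0 divr1 (_ : 1 - (1 - x) = x)//; ring.
rewrite iterS zoom_arc_false// IH; last by lra.
congr (f (arc false _) - _); rewrite exprS; field.
by rewrite expf_neq0.
Qed.

(** By its definition zoom g only involves differences g(z) - g(1) with z on the
   upper half circle, two of them at each point; here g is the n-th iterate. *)
Lemma iter_zoom_le n f (M : R) :
  (forall y, -1 <= y <= 1 ->
    normc (f (arc false (1 - (1 - y) / 2 ^+ n)) - f pt1) <= M) ->
  CT_norm (iter n.+1 zoom f) <= M + M.
Proof.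
move=> fM; apply: CT_norm_le_arc => s x xI; rewrite iterS zoomE//.
have {}xI : -1 <= x <= 1 by move: xI; rewrite in_itv/=.
have {}fM y : -1 <= y <= 1 ->
    normc (iter n zoom f (arc false y) - iter n zoom f pt1) <= M.
  by move=> yI; rewrite iter_zoom_arc_false//; exact: fM.
have NI : -1 <= (-1 : R) <= 1 by lra.
case: s; rewrite ?/zoom_lo ?/zoom_up.
  apply: (le_trans (le_normcD _ _)); apply: lerD; first by apply: fM; lra.
  rewrite normcM -[leRHS]mul1r ler_pM ?normc_ge0 ?fM//.
  by rewrite /= expr0n addr0 sqrtr_sqr ger0_norm; lra.
by apply: (le_trans (le_normcD _ _)); apply: lerD; apply: fM; lra.
Qed.

Let norm_diff_le f z w : normc (f z - f w) <= CT_norm f + CT_norm f.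
Proof.
rewrite (le_trans (le_normcD _ _))// lerD ?CT_norm_ub//.
by rewrite normcN CT_norm_ub.
Qed.

Lemma iter_zoom_bounded n f : `|iter n zoom f| <= 4%:C * `|f|.
Proof.
rewrite !CT_normE -rmorphM lecR -!/(CT_norm _).
have f0 := CT_norm_ge0 f; case: n => [|n]; first by rewrite /=; lra.
rewrite (le_trans (iter_zoom_le (M := CT_norm f + CT_norm f) _))//; lra.
Qed.

Lemma iter_zoom_cvg0 f : (fun n => iter n zoom f) @ \oo --> (0 : CT R).
Proof.
rewrite -cvg_shiftS; apply/cvgr0Pnorm_le => e /complex_gt0P[r r0 ->].
have cf : (fun x => f (arc false x)) @ (1 : R) --> (f pt1 : R[i]^o).
  apply: comp_arc_continuous => ?; exact: cvg_id.
have r20 : 0 < r / 2 by rewrite divr_gt0.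
have := (cvg_complexP (nbhs_filter (1 : R)) _ _).1 cf _ r20.
move=> /nbhs_ballP[d /= d0 fd].
have /cvgr0Pnorm_lt/(_ _ d0) : geometric 2 (2^-1 : R) @ \oo --> (0 : R).
  by apply: cvg_geometric; rewrite ger0_norm; lra.
apply: filterS => n nd; rewrite CT_normE lecR -/(CT_norm _) [r]splitr.
apply: iter_zoom_le => y yI; rewrite normc_distC; apply/ltW/fd.
have e2 : 0 < (2 : R)^-1 ^+ n by rewrite exprn_gt0.
rewrite -ball_normE /= opprB addrC subrK -exprVn; apply: le_lt_trans nd.
by rewrite /= !normrM ler_wpM2r// !ger0_norm; lra.
Qed.

Lemma squeeze_norm_le h : CT_norm (squeeze h) <= 2 * CT_norm h.
Proof.
apply: CT_norm_le_arc => s x xI; rewrite squeezeE//.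
have [x1 x2] : -1 <= x /\ x <= 1 by move: xI; rewrite in_itv /= => /andP[].
have wle (w : R) z : 0 <= w <= 1 -> normc (w%:C * h z) <= CT_norm h.
  move=> w01; rewrite normcM -[leRHS]mul1r ler_pM ?normc_ge0 ?CT_norm_ub//.
  by rewrite /= expr0n addr0 sqrtr_sqr ger0_norm; lra.
have h0 := CT_norm_ge0 h.
case: s; first by rewrite (le_trans (wle _ _ _))//; lra.
rewrite mulr_natl mulr2n; have [x0|/ltW x0] := leP x 0.
  rewrite squeeze_up_le0// (le_trans (le_normcD _ _))// lerD ?CT_norm_ub//.
  by rewrite normcN wle//; lra.
rewrite squeeze_up_ge0// norm_diff_le//.
Qed.

Lemma squeeze_norm_le_pt1 h : h pt1 = 0 -> CT_norm (squeeze h) <= CT_norm h.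
Proof.
move=> h1; apply: CT_norm_le_arc => s x xI; rewrite squeezeE//.
case: s; first by rewrite /squeeze_lo h1 mulr0 normc0 CT_norm_ge0.
have [x0|/ltW x0] := leP x 0.
  by rewrite squeeze_up_le0// h1 mulr0 subr0 CT_norm_ub.
by rewrite squeeze_up_ge0// h1 subr0 CT_norm_ub.
Qed.

(** Only the first application of squeeze can increase the norm: its values
   vanish at 1. *)
Lemma iter_squeeze_bounded n h : `|iter n squeeze h| <= 2%:C * `|h|.
Proof.
rewrite !CT_normE -rmorphM lecR -!/(CT_norm _).
have h0 := CT_norm_ge0 h; case: n => [|n]; first by rewrite /=; lra.
rewrite (le_trans _ (squeeze_norm_le h))//.
elim: n => // n IH; rewrite iterS (le_trans (squeeze_norm_le_pt1 _))//.
by rewrite iterS squeeze_pt1.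
Qed.

(** * Infinite dimension of the kernel of zoom *)

(** The factor 1 - x ^+ 2 makes the function on the lower half circle fit with 0
   on the upper one; up to this factor the family is that of the monomials. *)
Definition bump_lo (k : nat) x : R[i]^o := ((1 - x ^+ 2) * x ^+ k)%:C.

Lemma bump_lo_continuous k : continuous (bump_lo k).
Proof.
apply: complex_continuous => x; last exact: cvg_cst.
apply: cvgM; last exact: exprn_continuous.
by apply: cvgB; [exact: cvg_cst|exact: exprn_continuous].
Qed.

Let zero_continuous : continuous (fun _ : R => 0 : R[i]^o).
Proof. exact: cst_continuous. Qed.

Let bump_glue1 k : 0 = bump_lo k 1.
Proof. by rewrite /bump_lo expr1n subrr mul0r. Qed.

Let bump_glueN1 k : 0 = bump_lo k (-1).
Proof. by rewrite /bump_lo sqrrN expr1n subrr mul0r. Qed.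

Definition bump k : CT R := glue zero_continuous (@bump_lo_continuous k)
  (bump_glue1 k) (bump_glueN1 k).

Lemma zoom_bump k : zoom (bump k) = 0.
Proof.
have b0 x : x \in `[(-1), 1] -> bump k (arc false x) = 0 by exact: glueE.
apply: CT_ext_arc => s x xI; rewrite zoomE// CT0E.
have [x1 x2] : -1 <= x /\ x <= 1 by move: xI; rewrite in_itv /= => /andP[].
have yI : (1 + x) / 2 \in `[(-1), 1] by rewrite in_itv /=; lra.
have yNI : - ((1 + x) / 2) \in `[(-1), 1] by rewrite in_itv /=; lra.
by case: s; rewrite /zoom_lo /zoom_up !b0// !subrr ?mulr0 addr0.
Qed.

(** A vanishing combination gives a polynomial of size at most n that vanishes at
   all points of ]-1, 1[, in particular at 1/2, ..., 1/(n+1). *)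
Lemma bump_free n (a : 'I_n -> R[i]) :
  \sum_i a i *: bump i = 0 -> forall i, a i = 0.
Proof.
move=> a0.
have CT_sumE (I : finType) (F : I -> CT R) z : (\sum_i F i) z = \sum_i F i z.
  by apply: (big_morph (fun f : CT R => f z : R[i])).
pose p : {poly R[i]} := \poly_(k < n) (if insub k is Some i then a i else 0).
pose pt (k : nat) : R := (k.+2%:R)^-1.
have pt01 k : 0 < pt k < 1.
  by rewrite /pt invr_gt0 invf_lt1// ltr0n ltr1n.
have root_pt k : root p (pt k)%:C.
  have /andP[p0 p1] := pt01 k.
  have w0 : (1 - pt k ^+ 2)%:C != 0 :> R[i].
    rewrite -[0]/(0%:C) (inj_eq (@complexI R)) subr_eq0 eq_sym.
    by rewrite lt_eqF// expr_lt1// ltW.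
  have ptI : pt k \in `[(-1), 1] by rewrite in_itv /=; lra.
  have : (\sum_i a i *: bump i) (arc true (pt k)) = 0 by rewrite a0 CT0E.
  rewrite CT_sumE => a0k.
  apply/rootP/(mulfI w0); rewrite mulr0 -[RHS]a0k horner_poly mulr_sumr.
  apply: eq_bigr => i _; rewrite CTZE glueE// /bump_lo rmorphM rmorphXn /=.
  by rewrite valK mulrCA.
have p0 : p = 0.
  apply: (@roots_geq_poly_eq0 _ _ [seq (pt k)%:C | k <- iota 0 n]).
  - by apply/allP => _ /mapP[k _ ->].
  - rewrite map_inj_uniq ?iota_uniq// => k l /complexI/invr_inj/eqP.
    by rewrite eqr_nat => /eqP[].
  - by rewrite size_map size_iota size_poly.
move=> i; have := congr1 (fun q : {poly R[i]} => q`_i) p0.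
by rewrite /= coef_poly ltn_ord valK coef0.
Qed.

End operators.

Theorem proposition3p8 (R : realType) :
  has_uniform_multiplicity_infinity_of_infinite_index (CT R).
Proof.
have inf_dim (A : set (CT R)) : (forall k, A (bump k)) -> infinite_dimensional A.
  by move=> Ab n; exists (fun i : 'I_n => bump i); split=> //; exact: bump_free.
split; first exact: inf_dim.
exists (shift_unit squeeze zoom); split.
  apply: (is_matrix_units_shift squeezeK (K := 2) (L := 4)) => //.
  - exact: iter_squeeze_bounded.
  - exact: iter_zoom_bounded.
  - exact: iter_zoom_cvg0.
apply: inf_dim => k; apply: ker_sub_range_shift_unit; exact: zoom_bump.
Qed.
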